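(* Consider an $N$-token geometric mean market maker pool whose weights are moved from $\mathbf w^{\mathrm{start}}$ to $\mathbf w^{\mathrm{end}}$ in $f$ steps while asset prices follow driftless geometric Brownian motions. The cross term between weight and price changes does not affect the optimal interpolation path.
   Context: Weight vectors $\mathbf w=(w_1,\dots,w_N)$ have positive components summing to $1$, and $D_{\mathrm{KL}}(p\,\|\,q)=\sum_i p_i\log(p_i/q_i)$. The pool has invariant $\prod_i R_i^{w_i}$ (with $R_i$ the reserves), charges zero fees, and is perfectly arbitraged at every step. Each price satisfies $\mathrm dP_i/P_i=\sigma_i\,\mathrm dW_i$, so over one step of length $\Delta t$, $\mathbb E[\log(P_i^{(k)}/P_i^{(k-1)})]=-\sigma_i^2\Delta t/2$. An $f$-step interpolation path is a sequence $\mathbf w^{(0)}=\mathbf w^{\mathrm{start}},\mathbf w^{(1)},\dots,\mathbf w^{(f)}=\mathbf w^{\mathrm{end}}$ of weight vectors. At step $k$ the weights change from $\mathbf w^{(k-1)}$ to $\mathbf w^{(k)}$ and the prices from $P^{(k-1)}$ to $P^{(k)}$, and the pool value changes by $\log(V_k/V_{k-1})=-D_{\mathrm{KL}}(\mathbf w^{(k)}\,\|\,\mathbf w^{(k-1)})+\sum_i w_i^{(k)}\log(P_i^{(k)}/P_i^{(k-1)})$. Compared with a pool that holds its weights fixed at $\mathbf w^{(k-1)}$ over that step, the effective cost of the weight change is $D_{\mathrm{KL}}(\mathbf w^{(k)}\,\|\,\mathbf w^{(k-1)})-\sum_i (w_i^{(k)}-w_i^{(k-1)})\log(P_i^{(k)}/P_i^{(k-1)})$;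 the second term, which couples the weight change to the price change, is the cross term. Over the full $f$-step path (with final value $V_T=V_f$) the total expected log-loss is $\mathbb E[-\log(V_T/V_0)]=\sum_{k=1}^f D_{\mathrm{KL}}(\mathbf w^{(k)}\,\|\,\mathbf w^{(k-1)})+\frac{\Delta t}{2}\sum_{k=1}^f\sum_i w_i^{(k)}\sigma_i^2$. The optimal interpolation path is the $f$-step path with the given endpoints that minimises this total expected loss. *)

(* Defs.v *)
From HB Require Import structures.
From mathcomp Require Import all_boot all_order all_algebra.
From mathcomp Require Import all_classical all_reals all_analysis.

Set Implicit Arguments.
Unset Strict Implicit.
Unset Printing Implicit Defensive.

Import Order.TTheory GRing.Theory Num.Theory.
Import numFieldNormedType.Exports.

Local Open Scope classical_set_scope.
Local Open Scope ring_scope.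

(* Standard one-dimensional Brownian motion indexed by [0, +oo[; the values
   [W t] at negative times are irrelevant. *)
Record brownian_motion d (T : measurableType d) (R : realType)
    (P : probability T R) (W : R -> {RV P >-> R}) : Prop := {
  bm_start : forall x, W 0 x = 0 ;
  bm_normal_increments : forall s t, 0 <= s -> s < t ->
    forall A : set R, measurable A ->
    P [set x | A (W t x - W s x)] = normal_prob 0 (Num.sqrt (t - s)) A ;
  (* The sets [A j] are arbitrary and may be [setT], so the product rule over
     all [n] increments gives it over every subfamily. *)
  bm_independent_increments : forall (n : nat) (t : nat -> R)
      (A : 'I_n -> set R),
    0 <= t 0%N ->
    (forall j, (j < n)%N -> t j <= t j.+1) ->
    (forall j, measurable (A j)) ->
    P [set x | forall j : 'I_n, A j (W (t j.+1) x - W (t j) x)] =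
    (\prod_(j < n) P [set x | A j (W (t j.+1) x - W (t j) x)%R])%E ;
  bm_continuous :
    {ae P, forall x, {within `[0, +oo[, continuous (fun t => W t x)}} }.

(* Driftless geometric Brownian motion: the solution, with initial value [p0],
   of dS / S = sigma dW, driven by the Brownian path [W]. *)
Definition gbm (R : realType) (p0 sigma : R) (W : R -> R) (t : R) : R :=
  p0 * expR (sigma * W t - sigma ^+ 2 * t / 2).

Section Pool.
Context {R : realType} {N : nat}.
Implicit Types (w p r : nat -> 'I_N -> R) (u v : 'I_N -> R) (f k : nat).

Definition weight_vector v : Prop :=
  (forall i, 0 < v i) /\ \sum_i v i = 1.

Definition KL u v : R := \sum_i u i * ln (u i / v i).

(* Only the terms of index at most [f] of the sequence [w] are meaningful. *)
Definition interpolation_path f u v w : Prop :=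
  [/\ forall k, (k <= f)%N -> weight_vector (w k), w 0%N =1 u & w f =1 v].

Definition pool_value (q s : 'I_N -> R) : R := \sum_i q i * s i.

(* Reserves [r k] of a zero-fee geometric mean pool whose weights and market
   prices are [w k] and [p k] after step [k], started with reserves [r0].
   At step [k.+1] the weights are first changed at unchanged reserves [r k],
   then arbitrageurs trade along the level set of the invariant for the new
   weights, until the pool's quoted price of every token [i] in units of every
   token [j], (w i / r i) / (w j / r j), is the market one. *)
Record pool_trajectory f w p (r0 : 'I_N -> R) r : Prop := {
  pool_start : r 0%N =1 r0 ;
  pool_reserves_gt0 : forall k i, (k <= f)%N -> 0 < r k i ;
  pool_arbitraged : forall k i j, (k <= f)%N ->
    (w k i / r k i) / (w k j / r k j) = p k i / p k j ;
  pool_invariant : forall k, (k < f)%N ->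
    \prod_i (r k.+1 i) `^ (w k.+1 i) = \prod_i (r k i) `^ (w k.+1 i) }.

Definition log_return p k (i : 'I_N) : R := ln (p k.+1 i / p k i).

(* Log-loss, over the step from [k] to [k.+1], of a pool that holds its
   weights fixed at [w k]. *)
Definition fixed_weight_loss w p k : R := - \sum_i w k i * log_return p k i.

Definition cross_term w p k : R :=
  \sum_i (w k.+1 i - w k i) * log_return p k i.

(* What the weight change costs on top of [fixed_weight_loss]: the log-loss
   of the pool over the step is [fixed_weight_loss + effective_cost]. *)
Definition effective_cost w p k : R := KL (w k.+1) (w k) - cross_term w p k.

Definition log_loss f p r : R :=
  - ln (pool_value (r f) (p f) / pool_value (r 0%N) (p 0%N)).

(* The log-loss over [f] steps when the cross term is dropped from every
   [effective_cost]. *)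
Definition log_loss_without_cross f w p : R :=
  \sum_(k < f) (fixed_weight_loss w p k + KL (w k.+1) (w k)).

Definition optimal_path f u v (loss : (nat -> 'I_N -> R) -> \bar R) w : Prop :=
  interpolation_path f u v w /\
  forall w', interpolation_path f u v w' -> (loss w <= loss w')%E.

End Pool.

(* Main.v *)
Require Import Defs.
From HB Require Import structures.
From mathcomp Require Import all_boot all_order all_algebra.
From mathcomp Require Import all_classical all_reals all_analysis.
From mathcomp Require Import measurable_realfun ring.

Set Implicit Arguments.
Unset Strict Implicit.
Unset Printing Implicit Defensive.

Import Order.TTheory GRing.Theory Num.Theory.
Import numFieldNormedType.Exports.

Local Open Scope classical_set_scope.
Local Open Scope ring_scope.

(* Perfect arbitrage makes the value share of token [i] equal to its weight, so
   the invariant gives the log-value change of each step exactly, and the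
   log-loss of the pool is [log_loss_without_cross] minus the sum of the cross
   terms. All increments of length [dt] of the i-th Brownian motion have the
   same law, so the mean [m i] of the log-returns of token [i] is the same at
   every step.
   Hence the expected cross terms telescope to
   [\sum_i (wend i - wstart i) * m i], a constant that depends on the endpoints
   of the path only, and subtracting a constant does not change the minimisers.
   The value of [m i] is irrelevant; only integrability has to be proved. *)

(** * Pathwise algebra of an arbitraged pool *)

Section PoolTrajectory.
Context {R : realType} {N : nat}.
Implicit Types (w p r : nat -> 'I_N -> R) (u v q s : 'I_N -> R) (f k : nat).

Lemma ln_prod_powR (a b : 'I_N -> R) : (forall i, 0 < a i) ->
  ln (\prod_i a i `^ b i) = \sum_i b i * ln (a i).
Proof.
move=> a0; apply: expR_inj; rewrite lnK; last first.
  by rewrite posrE; apply: prodr_gt0 => i _; exact: powR_gt0.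
rewrite expR_sum; apply: eq_bigr => i _.
by rewrite /powR gt_eqF.
Qed.

(** Equality of quoted and market prices gives [u j * (q i * s i) = u i * (q j * s j)]; summing over
    [j] and using that the weights add up to 1 isolates [q i * s i]. *)
Lemma arbitraged_value_share u q s :
  weight_vector u -> (forall i, 0 < q i) -> (forall i, 0 < s i) ->
  (forall i j, (u i / q i) / (u j / q j) = s i / s j) ->
  forall i, q i * s i = u i * pool_value q s.
Proof.
move=> [u0 u1] q0 s0 arb i.
rewrite -[LHS]mul1r -u1 mulr_suml mulr_sumr; apply: eq_bigr => j _.
have := arb i j.
have [? ?] : q i != 0 /\ q j != 0 by split; exact: lt0r_neq0.
have [? ?] : u i != 0 /\ u j != 0 by split; exact: lt0r_neq0.
have sj : s j != 0 by exact: lt0r_neq0.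
move=> e.
suff : s i = u i / q i / (u j / q j) * s j by move=> ->; field; apply/and3P.
by rewrite e divfK.
Qed.

Lemma pool_value_gt0 u q s :
  weight_vector u -> (forall i, 0 < q i) -> (forall i, 0 < s i) ->
  0 < pool_value q s.
Proof.
move=> [_ u1] q0 s0; rewrite /pool_value.
(* Weights summing to 1 exclude the empty pool, whose value would be 0. *)
have [i0 _|N0] := pickP (@predT 'I_N); last first.
  by move: u1; rewrite big_pred0// => /eqP; rewrite eq_sym oner_eq0.
rewrite (bigD1 i0)//= ltr_pwDl ?mulr_gt0//.
by apply: sumr_ge0 => i _; rewrite mulr_ge0 ?ltW.
Qed.

Lemma ln_reserve u q s :
  weight_vector u -> (forall i, 0 < q i) -> (forall i, 0 < s i) ->
  (forall i j, (u i / q i) / (u j / q j) = s i / s j) ->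
  forall i, ln (q i) = ln (u i) + ln (pool_value q s) - ln (s i).
Proof.
move=> hu q0 s0 arb i; have V0 := pool_value_gt0 hu q0 s0.
have u0 : 0 < u i by case: hu.
rewrite -lnM ?posrE// -(arbitraged_value_share hu q0 s0 arb).
by rewrite lnM ?posrE ?addrK.
Qed.

Lemma log_value_change f w p (r0 : 'I_N -> R) r k :
  (forall l, (l <= f)%N -> weight_vector (w l)) ->
  (forall l i, 0 < p l i) -> pool_trajectory f w p r0 r -> (k < f)%N ->
  ln (pool_value (r k.+1) (p k.+1)) - ln (pool_value (r k) (p k)) =
  - KL (w k.+1) (w k) + \sum_i w k.+1 i * log_return p k i.
Proof.
move=> hw p0 [_ r0' arb inv] kf; have kf' := ltnW kf.
have wk := hw _ kf'; have wk1 := hw _ kf.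
have lnr :=
  ln_reserve wk (fun i => r0' k i kf') (p0 k) (fun i j => arb k i j kf').
have lnr1 :=
  ln_reserve wk1 (fun i => r0' _ i kf) (p0 k.+1) (fun i j => arb _ i j kf).
have := congr1 (@ln R) (inv _ kf).
rewrite !ln_prod_powR; [|by move=> i; exact: r0'|by move=> i; exact: r0'].
move=> e.
set V := ln (pool_value (r k) (p k)) in lnr *.
set V1 := ln (pool_value (r k.+1) (p k.+1)) in lnr1 *.
(* Writing 1 as the sum of the new weights turns both sides into sums over tokens. By [ln_reserve],
   their difference is then, term by term, the difference of the two sides of the logarithm of the
   invariant. *)
rewrite -[LHS]mul1r -wk1.2 mulr_suml /KL -sumrN -big_split/=.
apply/eqP; rewrite -subr_eq0 -sumrB; apply/eqP.
move/eqP: e; rewrite -subr_eq0 -sumrB => /eqP e; rewrite -[RHS]e.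
apply: eq_bigr => i _; rewrite lnr lnr1 /log_return.
by rewrite !ln_div ?posrE//; [ring|exact: wk1.1|exact: wk.1].
Qed.

(** The log-values telescope over the steps. In each step the return weighted by [w k.+1] splits
    into the one weighted by [w k] plus the cross term. *)
Lemma log_loss_cross_term f w p (r0 : 'I_N -> R) r :
  (forall k, (k <= f)%N -> weight_vector (w k)) ->
  (forall k i, 0 < p k i) -> pool_trajectory f w p r0 r ->
  log_loss f p r =
  log_loss_without_cross f w p - \sum_(k < f) cross_term w p k.
Proof.
move=> hw p0 hr; have [_ r0' _ _] := hr.
have V0 k : (k <= f)%N -> pool_value (r k) (p k) \is Num.pos.
  move=> kf; rewrite posrE; apply: pool_value_gt0 (hw _ kf) _ _ => // i.
  exact: r0'.
rewrite /log_loss ln_div ?V0//.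
rewrite -(@telescope_sumr _ 0 f (fun k => ln (pool_value (r k) (p k))))//.
rewrite big_mkord -sumrN /log_loss_without_cross -sumrB.
apply: eq_bigr => k _; rewrite (log_value_change hw p0 hr)//.
rewrite /fixed_weight_loss /cross_term.
under [X in _ - X]eq_bigr do rewrite mulrBl.
by rewrite sumrB; ring.
Qed.

(** Since [c] is real, adding it preserves and reflects the order even where a loss is infinite. *)
Lemma optimal_path_shift f u v
    (loss loss' : (nat -> 'I_N -> R) -> \bar R) (c : R) w :
  (forall w', interpolation_path f u v w' -> loss w' = (loss' w' + c%:E)%E) ->
  optimal_path f u v loss w <-> optimal_path f u v loss' w.
Proof.
move=> e; split=> -[pw hw]; split=> // w' pw'; have := hw _ pw'.
  by rewrite (e _ pw) (e _ pw') leeD2rE.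
by rewrite (e _ pw) (e _ pw') leeD2rE.
Qed.

End PoolTrajectory.

(** * The centred normal law has a first moment *)

Section NormalMoment.
Context {R : realType}.
Local Notation mu := (@lebesgue_measure R).

(** The Radon-Nikodym derivative of [normal_prob] agrees almost everywhere with [normal_pdf], as
    both have the same integral over every measurable set. *)
Lemma ge0_integral_normal_prob (m s : R) (g : R -> \bar R) : s != 0 ->
  (forall x, 0 <= g x)%E -> measurable_fun [set: R] g ->
  (\int[normal_prob m s]_x g x = \int[mu]_x (g x * (normal_pdf m s x)%:E))%E.
Proof.
move=> s0 g0 mg; have dom := @normal_prob_dominates R m s.
rewrite -(Radon_Nikodym_SigmaFinite.change_of_variables dom)//.
have fi := Radon_Nikodym_SigmaFinite.f_integrable dom.
have mpdf : measurable_fun [set: R] (EFin \o normal_pdf m s).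
  by apply/measurable_EFinP; exact: measurable_normal_pdf.
apply: ae_eq_integral => //.
- by apply: emeasurable_funM => //; exact: measurable_int fi.
- exact: emeasurable_funM.
- apply: ae_eqe_mul2l; apply: integral_ae_eq => //.
  by move=> E _ mE; rewrite -Radon_Nikodym_SigmaFinite.f_integral.
Qed.

(** Doubling the variance absorbs the factor [|x|]: the integrand is dominated by a multiple of the
    normal density of variance [2 * s ^+ 2], whose integral is 1. *)
Lemma integrable_normal_prob_id (s : R) : 0 < s ->
  (normal_prob 0 s).-integrable setT (fun x : R => x%:E).
Proof.
move=> s0; apply/integrableP; split; first exact/measurable_EFinP.
rewrite ge0_integral_normal_prob ?gt_eqF//; last exact: measurableT_comp.
have s20 : 0 < Num.sqrt 2 * s by rewrite mulr_gt0// sqrtr_gt0.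
(* The ratio of peaks matches the normalisations; the factor [s] is what the remaining bound
   [|x| * expR (- y) <= s], with [y] as below, requires. *)
pose c := normal_peak s * s / normal_peak (Num.sqrt 2 * s).
have np (t : R) : 0 < t -> 0 < normal_peak t.
  by move=> t0; rewrite normal_peak_gt0// gt_eqF.
have c0 : 0 <= c by rewrite divr_ge0 ?mulr_ge0 ?normal_peak_ge0 ?ltW.
apply: (@le_lt_trans _ _
    (\int[mu]_x (c%:E * (normal_pdf 0 (Num.sqrt 2 * s) x)%:E))%E); last first.
  rewrite ge0_integralZl//=; first by rewrite integral_normal_pdf mule1 ltry.
    by apply/measurable_EFinP; exact: measurable_normal_pdf.
  by move=> x _; rewrite lee_fin normal_pdf_ge0.
apply: ge0_le_integral => //=.
- by move=> x _; rewrite mule_ge0// lee_fin normal_pdf_ge0.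
- apply: emeasurable_funM; first exact: measurableT_comp.
  by apply/measurable_EFinP; exact: measurable_normal_pdf.
- apply: measurable_funeM; apply/measurable_EFinP.
  exact: measurable_normal_pdf.
move=> x _; rewrite -EFinM lee_fin !normal_pdfE ?gt_eqF//.
rewrite /c [leRHS]mulrA divfK ?gt_eqF ?np//.
rewrite mulrCA -mulrA ler_pM2l ?np//.
rewrite /normal_fun subr0 exprMn sqr_sqrtr//.
set y := x ^+ 2 / (s ^+ 2 *+ 4).
have -> : - x ^+ 2 / (s ^+ 2 *+ 2) = - y - y.
  by rewrite /y; field; rewrite gt_eqF.
have -> : - x ^+ 2 / (2 * s ^+ 2 *+ 2) = - y.
  by rewrite /y; field; rewrite gt_eqF.
rewrite expRD mulrA ler_pM2r ?expR_gt0// expRN ler_pdivrMr ?expR_gt0//.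
apply: le_trans (ler_wpM2l (ltW s0) (expR_ge1Dx y)).
(* AM-GM: |x| / s <= 1 + (x / 2s)^2 *)
have -> : s * (1 + y) = `|x| + s * (1 - `|x| / (s *+ 2)) ^+ 2.
  have -> : y = `|x| ^+ 2 / (s ^+ 2 *+ 4) by rewrite real_normK ?num_real.
  by field; rewrite gt_eqF.
by rewrite lerDl mulr_ge0 ?sqr_ge0 ?ltW.
Qed.

End NormalMoment.

(** * Transport of the first moment to a random variable with that law *)

Section NormalLaw.
Context d (T : measurableType d) {R : realType} (P : probability T R).
Context (X : {RV P >-> R}) (s : R).
Context (s0 : 0 < s).
Context (lawX :
  forall A : set R, measurable A -> P (X @^-1` A) = normal_prob 0 s A).

(* [R] and [measurableTypeR R] carry the same sigma-algebra under different
   displays; the measure [normal_prob 0 s] lives on the latter. *)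
Let Y : T -> measurableTypeR R := X.

Let mY : measurable_fun [set: T] Y.
Proof. exact: (measurable_funPT X). Qed.

Lemma integrable_normal_law : P.-integrable setT (EFin \o X).
Proof.
apply/integrableP; split; first exact/measurable_EFinP.
have /integrableP[_] := integrable_normal_prob_id s0.
congr (_ < _)%E; rewrite -[setT in RHS](preimage_setT Y).
rewrite -(ge0_integral_pushforward mY P (f := fun x => `|x%:E|%E))//.
  by apply: eq_measure_integral => A mA _; exact/esym/lawX.
exact: measurableT_comp.
Qed.

Lemma integral_normal_law :
  (\int[P]_x (X x)%:E = \int[normal_prob 0 s]_x x%:E)%E.
Proof.
rewrite -[setT in LHS](preimage_setT Y).
rewrite -(integral_pushforward mY (f := EFin))//.
  by apply: eq_measure_integral => A mA _; exact: lawX.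
exact: integrable_normal_law.
Qed.

End NormalLaw.

Lemma log_return_gbm (R : realType) (p0 sigma : R) (W : R -> R) (s t : R) :
  0 < p0 ->
  ln (gbm p0 sigma W t / gbm p0 sigma W s) =
  sigma * (W t - W s) - sigma ^+ 2 * (t - s) / 2.
Proof.
move=> p00; rewrite /gbm invfM mulrACA divff ?gt_eqF// mul1r.
by rewrite -expRN -expRD expRK; ring.
Qed.

(** * Stationary mean of the log-returns *)

Section LogReturns.
Context d (T : measurableType d) {R : realType} (P : probability T R).
Context (W : R -> {RV P >-> R}) (hW : brownian_motion W).
Context (p0 sigma dt : R) (hp0 : 0 < p0) (hdt : 0 < dt).

Let logret k x := ln (gbm p0 sigma (fun t => W t x) (k.+1%:R * dt)
                      / gbm p0 sigma (fun t => W t x) (k%:R * dt)).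

Lemma gbm_log_return_mean : exists m : R, forall k : nat,
  P.-integrable setT (EFin \o logret k) /\
  (\int[P]_x (logret k x)%:E = m%:E)%E.
Proof.
have sdt : 0 < Num.sqrt dt by rewrite sqrtr_gt0.
pose X k : {RV P >-> R} := (W (k.+1%:R * dt) - W (k%:R * dt)).
have lawX k (A : set R) : measurable A ->
    P (X k @^-1` A) = normal_prob 0 (Num.sqrt dt) A.
  move=> mA; have <- : k.+1%:R * dt - k%:R * dt = dt.
    by rewrite -mulrBl -natrB// subSnn mul1r.
  apply: (bm_normal_increments hW) => //; first by rewrite mulr_ge0 ?ler0n ?ltW.
  by rewrite ltr_pM2r// ltr_nat.
have iX k := integrable_normal_law sdt (lawX k).
(* The normal mean is left as an integral, which is free of [k]; integrability makes it finite, so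
   [fine] loses nothing. *)
exists (sigma * fine (\int[normal_prob 0 (Num.sqrt dt)]_x x%:E)%E
        - sigma ^+ 2 * dt / 2) => k.
have logretE : EFin \o logret k =
    (fun x => sigma%:E * (X k x)%:E - (sigma ^+ 2 * dt / 2)%:E)%E.
  apply/funext => x /=; rewrite /logret log_return_gbm// -mulrBl -natrB//.
  by rewrite subSnn mul1r.
have icst : P.-integrable setT (cst (sigma ^+ 2 * dt / 2)%:E).
  exact: finite_measure_integrable_cst.
have iZ := integrableZl measurableT sigma (iX k).
split; first by rewrite logretE; exact: integrableB.
under eq_integral do rewrite -[(_)%:E]/((EFin \o logret k) _) logretE.
rewrite integralB//.
have icstE : (\int[P]__ (sigma ^+ 2 * dt / 2)%:E = (sigma ^+ 2 * dt / 2)%:E)%E.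
  by have := expectation_cst P (sigma ^+ 2 * dt / 2); rewrite unlock.
rewrite integralZl ?iX// icstE EFinB (EFinM sigma).
rewrite -(integral_normal_law sdt (lawX k)) fineK//.
exact: (integrable_fin_num measurableT (iX k)).
Qed.

End LogReturns.

Theorem proposition4 (R : realType) (d : measure_display)
  (T : measurableType d) (P : probability T R)
  (N f : nat) (hf : (0 < f)%N)
  (wstart wend : 'I_N -> R)
  (hwstart : weight_vector wstart) (hwend : weight_vector wend)
  (dt : R) (hdt : 0 < dt)
  (sigma p0 r0 : 'I_N -> R) (hp0 : forall i, 0 < p0 i)
  (W : 'I_N -> R -> {RV P >-> R})
  (hW : forall i, brownian_motion (W i))
  (price : T -> nat -> 'I_N -> R)
  (hprice : forall x k i,
     price x k i = gbm (p0 i) (sigma i) (fun t => W i t x) (k%:R * dt))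
  (reserves : (nat -> 'I_N -> R) -> T -> nat -> 'I_N -> R)
  (hreserves : forall w, interpolation_path f wstart wend w ->
     forall x, pool_trajectory f w (price x) r0 (reserves w x)) :
  forall w : nat -> 'I_N -> R,
    optimal_path f wstart wend
      (fun w' => ('E_P[fun x => log_loss f (price x) (reserves w' x)])%E) w
    <->
    optimal_path f wstart wend
      (fun w' => ('E_P[fun x => log_loss_without_cross f w' (price x)])%E) w.
Proof.
have price_gt0 x k i : 0 < price x k i.
  by rewrite hprice /gbm mulr_gt0 ?expR_gt0.
have {hprice}log_returnE k x i : log_return (price x) k i =
    ln (gbm (p0 i) (sigma i) (fun t => W i t x) (k.+1%:R * dt)
        / gbm (p0 i) (sigma i) (fun t => W i t x) (k%:R * dt)).
  by rewrite /log_return !hprice.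
have [m hm] :=
  choice (fun i => gbm_log_return_mean (hW i) (sigma i) (hp0 i) hdt).
have ilr k i : P.-integrable setT (fun x => (log_return (price x) k i)%:E).
  by under eq_fun do rewrite log_returnE; exact: (hm i k).1.
have mlr k i : (\int[P]_x (log_return (price x) k i)%:E = (m i)%:E)%E.
  by under eq_integral do rewrite log_returnE; exact: (hm i k).2.
(* The coefficients are arbitrary so as to cover both [w k], for the fixed-weight loss, and
   [w k.+1 - w k], for the cross term. *)
have ilc c k : P.-integrable setT
    (fun x => (\sum_i c i * log_return (price x) k i)%:E).
  under eq_fun do rewrite -sumEFin.
  apply: integrable_sum => //= i _; under eq_fun do rewrite EFinM.
  exact: integrableZl.
have mlc c k : (\int[P]_x (\sum_i c i * log_return (price x) k i)%:E =
    (\sum_i c i * m i)%:E)%E.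
  under eq_integral do rewrite -sumEFin.
  rewrite integral_sum//=; last first.
    by move=> i; under eq_fun do rewrite EFinM; exact: integrableZl.
  rewrite -sumEFin; apply: eq_bigr => i _.
  by under eq_integral do rewrite EFinM; rewrite integralZl// mlr.
pose C := \sum_i (wend i - wstart i) * m i.
move=> w; apply: (optimal_path_shift (c := - C)) => {}w pw.
have [hw w0 wf] := pw.
have icross : P.-integrable setT
    (fun x => (\sum_(k < f) cross_term w (price x) k)%:E).
  under eq_fun do rewrite -sumEFin; apply: integrable_sum => //= k _.
  exact: (ilc (fun i => w k.+1 i - w k i)).
have iloss : P.-integrable setT
    (fun x => (log_loss_without_cross f w (price x))%:E).
  under eq_fun do rewrite -sumEFin; apply: integrable_sum => //= k _.
  under eq_fun do rewrite EFinD EFinN.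
  (* The divergence term does not depend on the sample point. *)
  apply: integrableD => //; first exact: integrableN.
  exact: finite_measure_integrable_cst.
have Ecross : (\int[P]_x (\sum_(k < f) cross_term w (price x) k)%:E = C%:E)%E.
  under eq_integral do rewrite -sumEFin.
  rewrite integral_sum//=; last first.
    by move=> k; exact: (ilc (fun i => w k.+1 i - w k i)).
  under eq_bigr do rewrite mlc.
  rewrite sumEFin exchange_big/=; congr EFin; apply: eq_bigr => i _.
  (* With the sums exchanged, [m i] factors out of the sum over steps and the weight increments of
     token [i] telescope to the prescribed endpoints. *)
  rewrite -mulr_suml -(big_mkord predT (fun k => w k.+1 i - w k i)).
  by rewrite telescope_sumr// w0 wf.
rewrite expectation.unlock.
under eq_integral => x _.
  rewrite (log_loss_cross_term hw (price_gt0 x) (hreserves w pw x)) EFinB.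
  over.
by rewrite integralB//= Ecross EFinN.
Qed.
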